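(* Let $H$ be a real Hilbert space and let $A$ be a self-adjoint nonnegative linear operator on $H$ with dense domain $D(A)$. Let $m:[0,+\infty)\to(0,+\infty)$ be a function of class $C^{1}$ with $\inf_{\sigma\geq 0}m(\sigma)>0$. Let $b:[0,+\infty)\to(0,+\infty)$ be a continuous function such that $$\int_{0}^{+\infty}b(s)\,ds<+\infty.$$ Let $(u_{0},u_{1})\in D(A)\times D(A^{1/2})$ be such that $|u_{1}|^{2}+|A^{1/2}u_{0}|^{2}>0$. Assume that for some $\varepsilon>0$ the problem $$\varepsilon u_{\varepsilon}''(t)+b(t)u_{\varepsilon}'(t)+m\bigl(|A^{1/2}u_{\varepsilon}(t)|^{2}\bigr)Au_{\varepsilon}(t)=0\quad\forall t\geq 0,\qquad u_{\varepsilon}(0)=u_{0},\quad u_{\varepsilon}'(0)=u_{1},$$ has a global solution $u_{\varepsilon}$. Then $$\liminf_{t\to+\infty}\left(|u_{\varepsilon}'(t)|^{2}+|A^{1/2}u_{\varepsilon}(t)|^{2}\right)>0.$$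
   Context: $|x|$ and $\langle x,y\rangle$ denote the norm and the scalar product in $H$. The operator $A$ is nonnegative in the sense that $\langle Ax,x\rangle\geq 0$ for all $x\in D(A)$; it is not assumed to be coercive. For $\alpha\geq 0$ the power $A^{\alpha}$, with domain $D(A^{\alpha})$, is defined by the spectral theorem, and $D(A^{\alpha})$ carries the graph norm. A global solution means a function $u_{\varepsilon}\in C^{2}([0,+\infty);H)\cap C^{1}([0,+\infty);D(A^{1/2}))\cap C^{0}([0,+\infty);D(A))$ satisfying the equation for all $t\geq 0$ and the initial conditions. *)

(* Defs.v *)
From HB Require Import structures.
From mathcomp Require Import all_boot all_order all_algebra.
From mathcomp Require Import all_classical all_reals all_analysis.
Set Implicit Arguments.
Unset Strict Implicit.
Unset Printing Implicit Defensive.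
Import Order.TTheory GRing.Theory Num.Theory.
Import numFieldNormedType.Exports.
Local Open Scope classical_set_scope.
Local Open Scope ring_scope.

(* Real Hilbert spaces are rendered as a [completeNormedModType R] together
   with a positive definite symmetric form [ip : {dot H for idfun}] inducing
   the norm. *)
Definition induces_norm (R : realType) (H : completeNormedModType R)
    (ip : {dot H for idfun}) : Prop :=
  forall x : H, `|x| ^+ 2 = ip x x.

(* The values of [ap] outside [dom] are irrelevant. *)
Record unbounded_op (R : realType) (H : completeNormedModType R) := UnboundedOp {
  dom : set H ;
  ap :> H -> H }.

Section Operators.
Context (R : realType) (H : completeNormedModType R).
Implicit Types (ip : {dot H for idfun}) (A : unbounded_op H).

Definition linear_op A : Prop :=
  dom A 0 /\
  forall (a : R) (x y : H), dom A x -> dom A y ->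
    dom A (a *: x + y) /\ A (a *: x + y) = a *: A x + A y.

(* The last clause is the equality of the graphs of the adjoint A* and of A. *)
Definition self_adjoint ip A : Prop :=
  [/\ linear_op A,
      dense (dom A) &
      forall y z : H,
        (forall x, dom A x -> ip (A x) y = ip x z) <-> (dom A y /\ A y = z)].

Definition nonnegative_op ip A : Prop :=
  forall x, dom A x -> 0 <= ip (A x) x.

Definition graph_norm A (x : H) : R := Num.sqrt (`|x| ^+ 2 + `|A x| ^+ 2).

(* The data produced by the spectral theorem in multiplication-operator form
   for a nonnegative operator A: a unitary map U of H onto a real space
   L^2(mu), written with representatives of the classes modulo a.e. equality,
   and a nonnegative multiplier f, such that U A U^-1 is the operator of
   multiplication by f on its maximal domain.  The measure space is arbitrary
   because H is not assumed separable. *)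
Record spectral_model A := SpectralModel {
  sm_disp : measure_display ;
  sm_space : measurableType sm_disp ;
  sm_mu : {measure set sm_space -> \bar R} ;
  sm_f : sm_space -> R ;
  sm_U : H -> sm_space -> R ;
  sm_f_measurable : measurable_fun [set: sm_space] sm_f ;
  sm_f_ge0 : forall s, 0 <= sm_f s ;
  sm_U_L2 : forall x, sm_U x \in Lfun sm_mu 2%:E ;
  sm_U_linear : forall (a : R) (x y : H),
    {ae sm_mu, forall s, sm_U (a *: x + y) s = a * sm_U x s + sm_U y s} ;
  sm_U_isometry : forall x : H,
    Lnorm sm_mu 2%:E (EFin \o sm_U x) = `|x|%:E ;
  sm_U_onto : forall g : sm_space -> R, g \in Lfun sm_mu 2%:E ->
    exists x, {ae sm_mu, forall s, sm_U x s = g s} ;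
  sm_dom : forall x,
    dom A x <-> (fun s => sm_f s * sm_U x s) \in Lfun sm_mu 2%:E ;
  sm_ap : forall x, dom A x ->
    {ae sm_mu, forall s, sm_U (A x) s = sm_f s * sm_U x s} }.

Arguments sm_f {A} M s : rename.
Arguments sm_U {A} M x s : rename.
Arguments sm_mu {A} M : rename.

(* A^alpha = U^-1 (multiplication by f^alpha) U on its maximal domain.  The
   spectral theorem provides a model, and the operator obtained does not
   depend on the model. *)
Definition op_power A (alpha : R) : unbounded_op H :=
  UnboundedOp
    [set x | exists M : spectral_model A,
       (fun s => sm_f M s `^ alpha * sm_U M x s) \in Lfun (sm_mu M) 2%:E]
    (fun x => xget 0 [set y | exists M : spectral_model A,
       {ae sm_mu M, forall s, sm_U M y s = sm_f M s `^ alpha * sm_U M x s}]).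

End Operators.

(* C^k([0,+oo); X) where X is the linear subspace D of V with the norm N.
   Limits are taken within [0,+oo), hence one-sided at t = 0; the values of
   functions at negative times are irrelevant. *)
Section HalfLine.
Context (R : realType) (V : normedModType R).

Definition quotient_filter (t : R) : set_system R :=
  within [set h | 0 <= t + h] 0^'.

Definition C0_half (D : set V) (N : V -> R) (u : R -> V) : Prop :=
  forall t, 0 <= t ->
    D (u t) /\ N (u s - u t) @[s --> within [set s | 0 <= s] (nbhs t)] --> (0 : R).

Definition is_deriv_half (N : V -> R) (u v : R -> V) : Prop :=
  forall t, 0 <= t ->
    N (h^-1 *: (u (t + h) - u t) - v t) @[h --> quotient_filter t] --> (0 : R).

Fixpoint Ck_half (k : nat) (D : set V) (N : V -> R) (u : R -> V) : Prop :=
  match k with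
  | 0%N => C0_half D N u
  | k'.+1 => C0_half D N u /\
      exists v : R -> V, is_deriv_half N u v /\ Ck_half k' D N v
  end.

Definition deriv_half (u : R -> V) (t : R) : V :=
  lim (h^-1 *: (u (t + h) - u t) @[h --> quotient_filter t]).

End HalfLine.

Record global_solution (R : realType) (H : completeNormedModType R)
    (A : unbounded_op H) (m b : R -> R) (eps : R) (u0 u1 : H) (u : R -> H)
    : Prop := GlobalSolution {
  gs_C2 : Ck_half 2 [set: H] (fun x => `|x|) u ;
  gs_C1 : Ck_half 1 (dom (op_power A 2^-1)) (graph_norm (op_power A 2^-1)) u ;
  gs_C0 : Ck_half 0 (dom A) (graph_norm A) u ;
  gs_eq : forall t, 0 <= t ->
    eps *: deriv_half (deriv_half u) t + b t *: deriv_half u t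
      + m (`|op_power A 2^-1 (u t)| ^+ 2) *: A (u t) = 0 ;
  gs_init0 : u 0 = u0 ;
  gs_init1 : deriv_half u 0 = u1 }.

(* Main.v *)
Require Import Defs.
From HB Require Import structures.
From mathcomp Require Import all_boot all_order all_algebra.
From mathcomp Require Import all_classical all_reals all_analysis.
From mathcomp Require Import measurable_realfun ring lra.
Set Implicit Arguments.
Unset Strict Implicit.
Unset Printing Implicit Defensive.
Import Order.TTheory GRing.Theory Num.Theory.
Import numFieldNormedType.Exports.
Local Open Scope classical_set_scope.
Local Open Scope ring_scope.

(* On D(A) the number |A^(1/2) x|^2 equals <A x, x>, so the energy
   E = eps |u'|^2 + M(|A^(1/2) u|^2), with M the primitive of m vanishing at 0,
   can be differentiated through s(t) = <A u(t), u(t)>, whose derivative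
   2 <A u, u'> only requires continuity of A u because A is symmetric.  The
   equation gives E' = - 2 b |u'|^2 >= - (2 b / eps) E, hence E stays above
   E(0) exp(- (2 / eps) int b) > 0.  As M is continuous at 0, E would be small
   whenever |u'|^2 + |A^(1/2) u|^2 is. *)

Arguments sm_f {R H A} M s : rename.
Arguments sm_U {R H A} M x s : rename.

(** * Polarization and squared L^2 norms *)

Lemma ip_sym (R : realType) (H : completeNormedModType R)
    (ip : {dot H for idfun}) x y : ip x y = ip y x.
Proof. by rewrite hermC expr0 mul1r. Qed.

Lemma ip_polarization (R : realType) (H : completeNormedModType R)
    (ip : {dot H for idfun}) (ip_norm : induces_norm ip) x y :
  4 * ip x y = `|x + y| ^+ 2 - `|x - y| ^+ 2.
Proof.
rewrite !ip_norm linearDr linearBr /= !(ip_sym ip (_ + _)) !linearDr !linearNr /=.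
rewrite (ip_sym ip y x); ring.
Qed.

Lemma Lnorm2_sqr d (T : measurableType d) (R : realType)
    (mu : {measure set T -> \bar R}) (g : T -> R) :
  (Lnorm mu 2%:E (EFin \o g) `^ 2 = \int[mu]_s (g s ^+ 2)%:E)%E.
Proof.
rewrite poweR_Lnorm //; apply: eq_integral => s _ /=.
by rewrite powR_mulrn // -normrX ger0_norm // sqr_ge0.
Qed.

(** * The quadratic form and the square root of [A] in a spectral model *)

Section SpectralModel.
Context (R : realType) (H : completeNormedModType R) (A : unbounded_op H).

(** Integrals of nonnegative measurable functions ignore null sets, so the isometry can be evaluated
    on any measurable representative of the class of [sm_U M x]. *)
Lemma sm_norm_sqr (M : spectral_model A) (x : H) (g : sm_space M -> R) :
  measurable_fun [set: sm_space M] g ->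
  {ae sm_mu M, forall s, sm_U M x s = g s} ->
  ((`|x| ^+ 2)%:E = \int[sm_mu M]_s (g s ^+ 2)%:E)%E.
Proof.
move=> mg Ug.
have mU : measurable_fun [set: sm_space M] (sm_U M x).
  by have /sub_Lfun_mfun := sm_U_L2 M x; rewrite inE.
rewrite -powR_mulrn // -poweR_EFin -(sm_U_isometry M x) Lnorm2_sqr.
apply: ge0_ae_eq_integral => //.
- by apply/measurable_EFinP; exact: measurable_funX.
- by apply/measurable_EFinP; exact: measurable_funX.
- by move=> s _; rewrite lee_fin sqr_ge0.
- by move=> s _; rewrite lee_fin sqr_ge0.
by apply: filterS Ug => s -> _.
Qed.

Lemma sm_form_integral (ip : {dot H for idfun}) (ip_norm : induces_norm ip)
    (M : spectral_model A) (x : H) : dom A x ->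
  ((ip (A x) x)%:E = \int[sm_mu M]_s (sm_f M s * sm_U M x s ^+ 2)%:E)%E.
Proof.
move=> Ax; set I := integral _ _ _.
(* Polarization through (f + 1)^2 = (f - 1)^2 + 4 f keeps every integrand
   nonnegative. *)
have mU : measurable_fun [set: sm_space M] (sm_U M x).
  by have /sub_Lfun_mfun := sm_U_L2 M x; rewrite inE.
have mf : measurable_fun [set: sm_space M] (sm_f M) by exact: sm_f_measurable.
have f0 s : 0 <= sm_f M s := sm_f_ge0 s.
have mUX : measurable_fun [set: sm_space M] (fun s => sm_U M x s ^+ 2).
  exact: measurable_funX.
have Dp := sm_U_linear M 1 (A x) x.
have Dm := sm_U_linear M (-1) x (A x).
have Np : ((`|A x + x| ^+ 2)%:E =
    \int[sm_mu M]_s (((sm_f M s + 1) * sm_U M x s) ^+ 2)%:E)%E.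
  apply: sm_norm_sqr.
    by apply: measurable_funM => //; exact: measurable_funD.
  apply: filterS2 Dp (sm_ap M Ax) => s; rewrite scale1r => -> ->; ring.
have Nm : ((`|A x - x| ^+ 2)%:E =
    \int[sm_mu M]_s (((sm_f M s - 1) * sm_U M x s) ^+ 2)%:E)%E.
  apply: sm_norm_sqr.
    by apply: measurable_funM => //; exact: measurable_funB.
  apply: filterS2 Dm (sm_ap M Ax) => s; rewrite scaleN1r addrC => -> ->; ring.
have I4 : ((`|A x + x| ^+ 2)%:E = (`|A x - x| ^+ 2)%:E + 4%:E * I)%E.
  rewrite Np Nm -ge0_integralZl //; last 2 first.
  - by apply/measurable_EFinP; exact: measurable_funM.
  - by move=> s _; rewrite lee_fin mulr_ge0 // sqr_ge0.
  rewrite -ge0_integralD //.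
  - by apply: eq_integral => s _; rewrite -EFinM -EFinD; congr (_%:E); ring.
  - by move=> s _; rewrite lee_fin sqr_ge0.
  - apply/measurable_EFinP; apply: measurable_funX.
    by apply: measurable_funM => //; exact: measurable_funB.
  - by move=> s _; rewrite -EFinM lee_fin mulr_ge0 // mulr_ge0 // sqr_ge0.
  - apply/measurable_EFinP; apply: measurable_funM => //.
    exact: measurable_funM.
have I0 : (0 <= I)%E.
  by apply: integral_ge0 => s _; rewrite lee_fin mulr_ge0 // sqr_ge0.
have := ip_polarization ip_norm (A x) x.
(* [I] is so far an extended real; the value +oo would make the finite number |A x + x|^2
   infinite. *)
move: I4 I0; case: I => [i| |] //= I4 _ P; last first.
  by move: I4; rewrite gt0_muley ?lte_fin // addey.
congr EFin; move: I4; rewrite -EFinM -EFinD => -[] I4.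
by move: P; rewrite I4 addrC addKr => /mulfI ->.
Qed.

(** [xget] may pick a vector coming from a model other than [M]. The form integral equals
    [ip (A x) x] in every model, so the norm can be computed in whichever model comes with the
    chosen vector; [M] only shows that a candidate exists. *)
Lemma op_power_half_norm (ip : {dot H for idfun}) (ip_norm : induces_norm ip)
    (M : spectral_model A) (x : H) : dom A x ->
  `|op_power A 2^-1 x| ^+ 2 = ip (A x) x.
Proof.
move=> Ax.
have mg (N : spectral_model A) : measurable_fun [set: sm_space N]
    (fun s => sm_f N s `^ 2^-1 * sm_U N x s).
  have /sub_Lfun_mfun := sm_U_L2 N x; rewrite inE /= => mU.
  apply: measurable_funM => //.
  by apply: (measurableT_comp (measurable_powR _)); exact: sm_f_measurable.
have gX (N : spectral_model A) s :
    (sm_f N s `^ 2^-1 * sm_U N x s) ^+ 2 = sm_f N s * sm_U N x s ^+ 2.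
  by rewrite exprMn powR12_sqrt ?sm_f_ge0 // sqr_sqrtr // sm_f_ge0.
(* Without a candidate [xget] would return its default 0. Square integrability holds because the
   integral of the square is the finite number [ip (A x) x]. *)
have ex : exists y, [set y | exists N : spectral_model A,
    {ae sm_mu N, forall s, sm_U N y s = sm_f N s `^ 2^-1 * sm_U N x s}] y.
  suff /sm_U_onto[y Uy] : (fun s => sm_f M s `^ 2^-1 * sm_U M x s)
      \in Lfun (sm_mu M) 2%:E by exists y; exists M.
  rewrite inE; apply/andP; split; rewrite inE //= /finite_norm.
  apply: (@lty_poweRy _ _ 2) => //; rewrite Lnorm2_sqr.
  under eq_integral do rewrite gX.
  by rewrite -(sm_form_integral ip_norm M) // ltry.
have [N UN] := xgetPex 0 ex.
apply: EFin_inj; rewrite (sm_norm_sqr (mg N) UN) (sm_form_integral ip_norm N) //.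
by apply: eq_integral => s _; rewrite gX.
Qed.

End SpectralModel.

(** * Limits and derivatives on the half-line *)

Section HalfLineCalculus.
Context (R : realType) (V : normedModType R).

Lemma quotient_filter_proper (t : R) : 0 <= t -> ProperFilter (quotient_filter t).
Proof.
move=> t0; apply: Build_ProperFilter_ex => P.
rewrite /quotient_filter /within /= => /nbhs_ballP[e /= e0 Pe].
exists (e / 2); apply: Pe => /=; last by rewrite addr_ge0 // divr_ge0 // ltW.
  by rewrite /ball /= sub0r normrN gtr0_norm ?divr_gt0 // ltr_pdivrMr // ltr_pMr // ltr1n.
by rewrite gt_eqF // divr_gt0.
Qed.

(** At an interior time the constraint [0 <= t + h] holds for all small [h], so the restricted
    quotients have ordinary two-sided limits. *)
Lemma dnbhs_quotient_filter (t : R) : 0 < t -> 0^' `=>` quotient_filter t.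
Proof.
move=> t0 P; rewrite /quotient_filter /within /= => nP.
have nt : \forall h \near (0 : R)^', 0 <= t + h.
  apply/nbhs_ballP; exists t => // h /=.
  rewrite /ball /= sub0r normrN => + _; rewrite ltr_norml => /andP[ht _].
  by rewrite addrC -lerBlDr sub0r ltW.
by apply: filterS2 nP nt => h; apply.
Qed.

Lemma C0_half_cvg (D : set V) (u : R -> V) (t : R) :
  C0_half D (fun x => `|x|) u -> 0 <= t ->
  u s @[s --> within [set s | 0 <= s] (nbhs t)] --> u t.
Proof. by move=> Cu t0; have [_] := Cu t t0; move/norm_cvg0/subr_cvg0. Qed.

Lemma is_deriv_half_quotient (u v : R -> V) (t : R) :
  is_deriv_half (fun x => `|x|) u v -> 0 <= t ->
  h^-1 *: (u (t + h) - u t) @[h --> quotient_filter t] --> v t.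
Proof.
move=> uv t0; have PF := quotient_filter_proper t0.
by have := uv t t0; move/norm_cvg0/subr_cvg0.
Qed.

Lemma is_deriv_half_cvg (u v : R -> V) (t : R) :
  is_deriv_half (fun x => `|x|) u v -> 0 < t ->
  h^-1 *: (u (t + h) - u t) @[h --> 0^'] --> v t.
Proof.
move=> uv t0; apply: cvg_trans (is_deriv_half_quotient uv (ltW t0)).
by apply: cvg_app; exact: dnbhs_quotient_filter.
Qed.

Lemma deriv_halfE (u v : R -> V) (t : R) :
  is_deriv_half (fun x => `|x|) u v -> 0 <= t -> deriv_half u t = v t.
Proof.
move=> uv t0; have PF := quotient_filter_proper t0.
by apply: cvg_lim => //; exact: is_deriv_half_quotient.
Qed.

(** Serves to differentiate [deriv_half u], which is identified with the first derivative [v] of [u]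
    at nonnegative times only. *)
Lemma eq_is_deriv_half (u w v : R -> V) : (forall t, 0 <= t -> u t = w t) ->
  is_deriv_half (fun x => `|x|) u v -> is_deriv_half (fun x => `|x|) w v.
Proof.
move=> uw uv t t0; have PF := quotient_filter_proper t0.
apply: cvg_trans (uv t t0); apply: near_eq_cvg.
by apply: filterS (withinT _ _) => h /= th; rewrite !uw.
Qed.

Lemma within_nbhs_pos (T : topologicalType) (f : R -> T) (l : T) (t : R) : 0 < t ->
  f s @[s --> within [set s | 0 <= s] (nbhs t)] --> l -> f s @[s --> t] --> l.
Proof.
move=> t0 fl; apply: cvg_trans fl; apply: cvg_app => P.
rewrite /within /= => nP; rewrite nbhs_filterE; near=> s.
have s0 : 0 <= s by near: s; exact: lt_le_nbhsr.
by move: s0; near: s.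
Unshelve. all: by end_near. Qed.

End HalfLineCalculus.

(** * Continuity and differentiation of scalar products *)

Section InnerProductCalculus.
Context (R : realType) (H : completeNormedModType R) (ip : {dot H for idfun}).
Hypothesis ip_norm : induces_norm ip.

(** Polarization reduces joint continuity of the form to continuity of the norm. *)
Lemma cvg_ip (T : Type) (F : set_system T) (FF : Filter F) (f g : T -> H) (x y : H) :
  f @ F --> x -> g @ F --> y -> ip (f s) (g s) @[s --> F] --> ip x y.
Proof.
move=> fx gy.
have E z w : ip z w = 4^-1 * (`|z + w| * `|z + w| - `|z - w| * `|z - w|).
  by rewrite -!expr2 -(ip_polarization ip_norm) mulKf.
under eq_fun do rewrite E.
rewrite E; apply: cvgMr; apply: cvgB; apply: cvgM; apply: cvg_norm;
  by [apply: cvgD | apply: cvgB].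
Qed.

(* The symmetry hypothesis on [w] covers both [w = p] and [w = A p]; in the
   latter case only continuity of [w], not differentiability, is available. *)
Lemma is_derive_ip (p w : R -> H) (p' : H) (t : R) :
  h^-1 *: (p (t + h) - p t) @[h --> 0^'] --> p' ->
  w s @[s --> t] --> w t ->
  (\forall h \near 0^', ip (p t) (w (t + h)) = ip (p (t + h)) (w t)) ->
  is_derive t 1 (fun s => ip (p s) (w s)) (2 * ip p' (w t)).
Proof.
move=> dp cw sym.
have cw' : w (t + h) @[h --> 0^'] --> w t.
  suff th : t + h @[h --> (0 : R)^'] --> t by apply: cvg_comp th cw.
  apply: cvg_within_filter; have := cvgD (cvg_cst t) (@cvg_id _ (nbhs (0 : R))).
  by rewrite addr0 => L; exact: L.
suff L : h^-1 *: (((fun s => ip (p s) (w s)) \o shift t) (h *: 1)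
    - ip (p t) (w t)) @[h --> 0^'] --> 2 * ip p' (w t).
  by split; [apply/cvg_ex; eexists; exact: L|exact: cvg_lim L].
(* By [sym] the cross terms cancel, and the increment of [ip (p s) (w s)] factors as
   [ip (p (t + h) - p t) (w (t + h) + w t)]. *)
have -> : 2 * ip p' (w t) = ip p' (w t + w t) by rewrite linearDr /=; ring.
apply: cvg_trans (cvg_ip _ dp (cvgD cw' (cvg_cst (w t)))).
apply: near_eq_cvg; near=> h.
have S : ip (p t) (w (t + h)) = ip (p (t + h)) (w t) by near: h.
rewrite /= scaler1 (addrC h t) ip_sym linearZr_LR /= ip_sym.
rewrite linearDr /= !(ip_sym ip (_ - _)) !linearBr /=.
rewrite (ip_sym ip _ (p (t + h))) (ip_sym ip _ (p t)) S.
rewrite (ip_sym ip (w t)) (ip_sym ip (w t)) /GRing.scale /=; congr (_ * _); ring.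
Unshelve. all: by end_near. Qed.

End InnerProductCalculus.

(** * Primitives and a Gronwall inequality *)

Section RealCalculus.
Context (R : realType).
Local Notation mu := (@lebesgue_measure R).

Lemma continuous_antiderivative (g : R -> R) (a : R) : continuous g ->
  exists G : R -> R, forall x : R, a < x -> is_derive x 1 G (g x).
Proof.
move=> cg; exists (fun x => \int[mu]_(s in `[a, x]) g s) => x ax.
(* The right end [x + 1] keeps [x] interior to the interval of integration. *)
have x1 : x < x + 1 by rewrite ltrDl.
have ig : mu.-integrable `[a, x + 1] (EFin \o g).
  by apply: continuous_compact_integrable; [exact: segment_compact|exact: continuous_subspaceT].
have [dG G'] := continuous_FTC1_closed x1 ig ax (cg x).
by split; [exact: dG|rewrite -derive1E].
Qed.

Lemma is_derive_cc_continuous (f df : R -> R) (a b c : R) : c < a ->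
  (forall x : R, c < x -> is_derive x 1 f (df x)) -> {within `[a, b], continuous f}.
Proof.
move=> ca df_; apply: derivable_within_continuous => x.
rewrite in_itv /= => /andP[ax _].
by have [] := df_ x (lt_le_trans ca ax).
Qed.

(** With [B] the primitive of [b] from 0, the integrating factor [expR (k * B t)] makes
    [E t * expR (k * B t)] nondecreasing; then [B t] is bounded by the whole integral. *)
Lemma gronwall_lower (E b : R -> R) (k : R) : 0 <= k ->
  (forall t : R, 0 <= t -> 0 <= b t) -> {within `[0, +oo[, continuous b} ->
  (\int[mu]_(s in `[0%R, +oo[) (b s)%:E < +oo)%E ->
  {within [set t | 0 <= t], continuous E} -> 0 <= E 0 ->
  (forall t : R, 0 < t -> exists2 d : R, is_derive t 1 E d & - (k * b t * E t) <= d) ->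
  forall t : R, 0 <= t ->
  E 0 * expR (- (k * \int[mu]_(s in `[0, +oo[) b s)) <= E t.
Proof.
move=> k0 b0 cb ib cE E0 dE t t0.
have bI T : mu.-integrable `[0, T] (EFin \o b).
  apply: continuous_compact_integrable; first exact: segment_compact.
  by apply: continuous_subspaceW cb; exact: subset_itvl.
pose B x := \int[mu]_(s in `[0, x]) b s.
have dB (x : R) : 0 < x -> is_derive x 1 B (b x).
  move=> x0; have x1 : x < x + 1 by rewrite ltrDl.
  have cbx : {for x, continuous b}.
    apply: (within_nbhs_pos x0).
    have -> : [set s : R | 0 <= s] = `[0, +oo[%classic.
      by apply/seteqP; split => y /=; rewrite in_itv /= andbT.
    by move/subspace_continuousP : cb => /(_ x); apply; rewrite /= in_itv /= andbT ltW.
  have [dG B'] := continuous_FTC1_closed x1 (bI (x + 1)) x0 cbx.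
  by split; [exact: dG|rewrite -derive1E].
have BI x : B x <= \int[mu]_(s in `[0, +oo[) b s.
  rewrite /B /Rintegral fine_le //.
  - exact: integrable_fin_num.
  - rewrite ge0_fin_numE //; apply: integral_ge0 => s /=.
    by rewrite in_itv /= andbT lee_fin; exact: b0.
  - apply: ge0_subset_integral => //.
    + by apply/measurable_EFinP; exact: subspace_continuous_measurable_fun.
    + by move=> s /=; rewrite in_itv /= andbT lee_fin; exact: b0.
    + exact: subset_itvl.
have B00 : B 0 = 0 by rewrite /B set_itv1 Rintegral_set1.
pose F x := E x * expR (k * B x).
have dF (x : R) : 0 < x -> derivable F x 1 /\ 0 <= derive1 F x.
  move=> x0; have [d dEx dge] := dE x x0.
  have dBx := dB x x0.
  have dkB : is_derive x 1 (fun y => k * B y) (k * b x) by exact: is_deriveZ.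
  have dX := @is_derive1_comp _ expR (fun y => k * B y) _ _ _ (is_derive_expR (k * B x)) dkB.
  have [dFx F'] := is_deriveM dEx dX.
  split => //; rewrite derive1E F' /= /GRing.scale /=.
  have -> : E x * (expR (k * B x) * (k * b x)) + expR (k * B x) * d
    = expR (k * B x) * (d + k * b x * E x) by ring.
  by rewrite mulr_ge0 ?expR_ge0 //; lra.
(* Continuity up to 0 extends the monotonicity from positive times to the closed interval. *)
have cF : {within `[0, t], continuous F}.
  apply/subspace_continuousP => x xt; apply: cvgM.
    move/subspace_continuousP : cE => /(_ x) cE.
    apply: cvg_trans (cE _); last by move: xt; rewrite /= in_itv /= => /andP[].
    apply: cvg_app; apply: within_subset => //.
    by move=> s; rewrite /= in_itv /= => /andP[].
  apply: continuous_cvg; first exact: continuous_expR.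
  apply: cvgMr.
  by have /subspace_continuousP := parameterized_integral_continuous t0 (bI t); apply.
have F0t : F 0 <= F t.
  apply: (ger0_derive1_le_cc _ _ cF) => //.
  - by move=> x; rewrite in_itv /= => /andP[/dF[]].
  - by move=> x; rewrite in_itv /= => /andP[/dF[]].
  - by rewrite in_itv /= lexx.
  - by rewrite in_itv /= t0 lexx.
move: F0t; rewrite /F B00 mulr0 expR0 mulr1 => EF.
have -> : E t = (E t * expR (k * B t)) * expR (- (k * B t)).
  by rewrite -mulrA -expRD subrr expR0 mulr1.
apply: ler_pM; [exact: E0|exact: expR_ge0|exact: EF|].
by rewrite ler_expR lerN2 ler_wpM2l.
Qed.

End RealCalculus.

(** * Symmetry of [A], graph-norm continuity, and extension of [m] *)

Lemma self_adjoint_sym (R : realType) (H : completeNormedModType R)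
    (ip : {dot H for idfun}) (A : unbounded_op H) (x y : H) :
  self_adjoint ip A -> dom A x -> dom A y -> ip x (A y) = ip (A x) y.
Proof.
move=> [_ _ A_adj] Ax Ay.
(* The pair [(y, A y)] lies in the graph of [A], hence in that of its adjoint. *)
by have [_ /(_ (conj Ay erefl))/(_ x Ax)] := A_adj y (A y).
Qed.

(** The graph norm of [u s - u t] dominates the norm of its image under [A], which linearity on the
    domain splits into [A (u s) - A (u t)]. *)
Lemma C0_half_graph (R : realType) (H : completeNormedModType R)
    (A : unbounded_op H) (u : R -> H) :
  linear_op A -> C0_half (dom A) (graph_norm A) u ->
  C0_half [set: H] (fun x => `|x|) (fun s => A (u s)).
Proof.
move=> [_ A_lin] Cu t t0; split=> //; have [ut gu] := Cu t t0.
apply: (squeeze_cvgr _ (cvg_cst 0) gu).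
apply: filterS (withinT _ _) => s /= s0; rewrite normr_ge0 /=.
have [us _] := Cu s s0.
have [_ /= E] := A_lin (-1) _ _ ut us.
have -> : A (u s) - A (u t) = A (u s - u t).
  by rewrite addrC -scaleN1r -E scaleN1r [in RHS]addrC.
rewrite /graph_norm -[leLHS]normr_id -sqrtr_sqr ler_wsqrtr //.
by rewrite lerDr sqr_ge0.
Qed.

(* Extending m evenly makes its primitive differentiable on both sides of 0,
   a value that |A^(1/2) u|^2 may take. *)
Lemma C0_half_even_extension (R : realType) (m : R -> R) :
  C0_half [set: R^o] (fun x => `|x|) (m : R -> R^o) ->
  continuous (fun s : R => m `|s|).
Proof.
move=> Cm s; have := C0_half_cvg Cm (normr_ge0 s); apply: cvg_comp.
move=> P; rewrite /within /= => nP.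
have nQ : \forall y \near s, 0 <= `|y| -> P `|y| := @norm_continuous _ R^o s _ nP.
change (\forall y \near s, P `|y|).
by apply: filterS nQ => y /=; apply.
Qed.

(** * Regularity of the two quantities entering the energy *)

Section Energy.
Context (R : realType) (H : completeNormedModType R) (ip : {dot H for idfun}).
Hypothesis ip_norm : induces_norm ip.
Context (A : unbounded_op H) (A_sa : self_adjoint ip A).
Context (u v w : R -> H).
Hypothesis Cu : C0_half (dom A) (graph_norm A) u.
Hypothesis uv : is_deriv_half (fun x => `|x|) u v.
Hypothesis vw : is_deriv_half (fun x => `|x|) v w.
Hypothesis Cu0 : C0_half [set: H] (fun x => `|x|) u.
Hypothesis Cv : C0_half [set: H] (fun x => `|x|) v.

Let A_lin : linear_op A. Proof. by case: A_sa. Qed.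
Let CAu := C0_half_graph A_lin Cu.

Lemma is_derive_form (t : R) : 0 < t ->
  is_derive t 1 (fun s => ip (u s) (A (u s))) (2 * ip (v t) (A (u t))).
Proof.
move=> t0; apply: (is_derive_ip ip_norm).
- exact: is_deriv_half_cvg uv t0.
- exact: within_nbhs_pos t0 (C0_half_cvg CAu (ltW t0)).
(* Symmetry of [A] needs both [u t] and [u (t + h)] in the domain, which is known when
   [0 <= t + h]. *)
apply: (dnbhs_quotient_filter t0); apply: filterS (withinT _ _) => h /= th.
have [ut _] := Cu (ltW t0); have [uth _] := Cu th.
by rewrite (self_adjoint_sym A_sa) // ip_sym.
Qed.

Lemma is_derive_normsq (t : R) : 0 < t ->
  is_derive t 1 (fun s => ip (v s) (v s)) (2 * ip (w t) (v t)).
Proof.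
move=> t0; apply: (is_derive_ip ip_norm).
- exact: is_deriv_half_cvg vw t0.
- exact: within_nbhs_pos t0 (C0_half_cvg Cv (ltW t0)).
by apply: nearW => h; rewrite ip_sym.
Qed.

Lemma form_within_continuous :
  {within [set t : R | 0 <= t], continuous (fun s => ip (u s) (A (u s)))}.
Proof.
apply/subspace_continuousP => t /= t0; apply: cvg_ip => //.
  exact: C0_half_cvg Cu0 t0.
exact: C0_half_cvg CAu t0.
Qed.

Lemma normsq_within_continuous :
  {within [set t : R | 0 <= t], continuous (fun s => ip (v s) (v s))}.
Proof.
by apply/subspace_continuousP => t /= t0; apply: cvg_ip => //; exact: C0_half_cvg Cv t0.
Qed.

End Energy.

(** The lower limit is a supremum of infima over the sets of the filter, and the half-line from 0 is
    one of these sets. *)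
Lemma limf_einf_gt0 (R : realType) (g : R -> R) (r : R) : 0 < r ->
  (forall t, 0 <= t -> r <= g t) ->
  (0 < limf_einf (fun t : R => (g t)%:E) (+oo%R : set_system R))%E.
Proof.
move=> r0 rg; rewrite limf_einfE.
apply: (@lt_le_trans _ _ r%:E); first by rewrite lte_fin.
apply: le_trans (ereal_sup_ubound _); last first.
  by exists [set t : R | 0 <= t] => //; exact: nbhs_pinfty_ge.
by apply: le_ereal_inf_tmp => _ [t /= t0 <-]; rewrite lee_fin rg.
Qed.

(** * Energy estimate for the solution and conclusion *)

Theorem theorem2p3 (R : realType) (H : completeNormedModType R)
    (ip : {dot H for idfun}) (ip_norm : induces_norm ip)
    (A : unbounded_op H)
    (A_sa : self_adjoint ip A) (A_ge0 : nonnegative_op ip A)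
    (m : R -> R)
    (m_gt0 : forall sigma, 0 <= sigma -> 0 < m sigma)
    (m_C1 : Ck_half 1 [set: R^o] (fun x => `|x|) (m : R -> R^o))
    (m_inf : 0 < inf [set m sigma | sigma in `[0, +oo[])
    (b : R -> R)
    (b_gt0 : forall t, 0 <= t -> 0 < b t)
    (b_cont : {within `[0, +oo[, continuous b})
    (b_int : (\int[lebesgue_measure]_(s in `[0%R, +oo[) (b s)%:E < +oo)%E)
    (u0 u1 : H)
    (u0_dom : dom A u0) (u1_dom : dom (op_power A 2^-1) u1)
    (data_neq0 : 0 < `|u1| ^+ 2 + `|op_power A 2^-1 u0| ^+ 2)
    (eps : R) (eps_gt0 : 0 < eps)
    (u : R -> H) (u_sol : global_solution A m b eps u0 u1 u) :
  (0 < limf_einf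
         (fun t : R => (`|deriv_half u t| ^+ 2
                        + `|op_power A 2^-1 (u t)| ^+ 2)%:E)
         (+oo%R : set_system R))%E.
Proof.
(* Membership in the domain of the square root carries a spectral model of [A]. *)
have [M0 _] := u1_dom.
have [Cu0 [v [uv [Cv [w [vw _]]]]]] := gs_C2 u_sol.
have Cu := gs_C0 u_sol.
have vE t : 0 <= t -> deriv_half u t = v t by exact: deriv_halfE.
have wE t : 0 <= t -> deriv_half (deriv_half u) t = w t.
  apply: deriv_halfE; apply: eq_is_deriv_half vw => s s0.
  by rewrite vE.
have sE t : 0 <= t -> `|op_power A 2^-1 (u t)| ^+ 2 = ip (u t) (A (u t)).
  by move=> t0; rewrite (op_power_half_norm ip_norm M0) 1?ip_sym //; have [] := Cu t t0.
have s_ge0 t : 0 <= t -> 0 <= ip (u t) (A (u t)).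
  by move=> t0; rewrite -sE // sqr_ge0.
have cm := C0_half_even_extension (proj1 m_C1).
(* Base point -1 makes 0 an interior point. Since [M 0] need not vanish, the potential energy is
   written [M s - M 0]. *)
have [M dM] := continuous_antiderivative (-1) cm.
have Ngt (s : R) : 0 <= s -> -1 < s by move=> s0; lra.
(* The form [m c * s] gives the sign of the potential energy, and its positivity for [s > 0], needed
   for [E 0 > 0]. *)
have M_mvt (s : R) : 0 <= s -> exists2 c : R, 0 <= c & M s - M 0 = m c * s.
  move=> s0; have dM0 x : x \in `]0, s[ -> is_derive x 1 M (m `|x|).
    by rewrite in_itv /= => /andP[x0 _]; apply: dM; exact/Ngt/ltW.
  have [c + ->] := MVT_segment s0 dM0 (is_derive_cc_continuous (Ngt 0 (lexx 0)) dM).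
  by rewrite in_itv /= => /andP[c0 _]; exists c => //; rewrite ger0_norm // subr0.
have M_ge (s : R) : 0 <= s -> 0 <= M s - M 0.
  by move=> s0; have [c c0 ->] := M_mvt s s0; rewrite mulr_ge0 // ltW // m_gt0.
pose E t := eps * ip (v t) (v t) + (M (ip (u t) (A (u t))) - M 0).
have v_ge0 t : 0 <= ip (v t) (v t) by rewrite -ip_norm sqr_ge0.
have E_gt0 : 0 < E 0.
  move: data_neq0; rewrite -(gs_init1 u_sol) -(gs_init0 u_sol) vE // sE // ip_norm /E.
  have [c c0 ->] := M_mvt _ (s_ge0 0 (lexx 0)).
  have := s_ge0 0 (lexx 0); have := v_ge0 0; have := m_gt0 c c0.
  move: (m c) (ip (v 0) _) (ip (u 0) _) => mc x y mc0.
  rewrite !le_eqVlt => /predU1P[<-|x0] /predU1P[<-|y0]; rewrite ?mulr0 ?add0r ?addr0 ?ltxx // => _.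
  - by rewrite mulr_gt0.
  - by rewrite mulr_gt0.
  - by rewrite addr_gt0 // mulr_gt0.
have E_cont : {within [set t : R | 0 <= t], continuous E}.
  apply/subspace_continuousP => t /= t0; apply: cvgD.
    by apply: cvgMr; have /subspace_continuousP := normsq_within_continuous ip_norm Cv; apply.
  apply: cvgB; last exact: cvg_cst.
  apply: continuous_cvg.
    by have [/derivable1_diffP/differentiable_continuous] := dM _ (Ngt _ (s_ge0 t t0)).
  by have /subspace_continuousP := form_within_continuous ip_norm A_sa Cu Cu0; apply.
have E_decay (t : R) : 0 < t -> exists2 d : R, is_derive t 1 E d &
    - (2 / eps * b t * E t) <= d.
  move=> t0; have t0' := ltW t0.
  have dv := is_derive_normsq ip_norm vw Cv t0.
  have ds := is_derive_form ip_norm A_sa Cu uv t0.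
  have dMs := @is_derive1_comp _ M (fun s => ip (u s) (A (u s))) _ _ _
    (dM _ (Ngt _ (s_ge0 t t0'))) ds.
  have dE := is_deriveD (is_deriveZ eps dv) (is_deriveB dMs (is_derive_cst (M 0) t 1)).
  eexists; first exact: dE.
  (* Pairing the equation with [v t] shows that the derivative of [E] is
     [- 2 * b t * ip (v t) (v t)]. *)
  have energy_eq : eps * ip (w t) (v t) + b t * ip (v t) (v t)
      + m (ip (u t) (A (u t))) * ip (v t) (A (u t)) = 0.
    have /(congr1 (ip (v t))) := gs_eq u_sol t0'.
    by rewrite wE // vE // sE // !linearDr !linearZr_LR /= linear0r (ip_sym ip (w t)).
  rewrite ger0_norm ?s_ge0 // subr0 /E /GRing.scale /=.
  (* This is the potential part of [2 / eps * b t * E t]; the kinetic part is exactly the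
     dissipation, so dropping a nonnegative term gives the inequality. *)
  have a_ge0 := mulr_ge0 (mulr_ge0 (divr_ge0 (ler0n R 2) (ltW eps_gt0))
    (ltW (b_gt0 t t0'))) (M_ge _ (s_ge0 t t0')).
  rewrite mulrDr.
  have -> : 2 / eps * b t * (eps * ip (v t) (v t)) = 2 * (b t * ip (v t) (v t)).
    by field; rewrite gt_eqF.
  lra.
pose c := E 0 * expR (- (2 / eps * \int[lebesgue_measure]_(s in `[0, +oo[) b s)).
have c_gt0 : 0 < c by rewrite mulr_gt0 // expR_gt0.
have E_ge t : 0 <= t -> c <= E t.
  apply: gronwall_lower => //.
  - by rewrite divr_ge0 // ltW.
  - by move=> s s0; exact/ltW/b_gt0.
  - exact: ltW.
have [r r0 Mr] : exists2 r : R, 0 < r & forall s, 0 <= s -> s < r -> M s - M 0 < c / 2.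
  have cM : {for 0, continuous M}.
    by have [/derivable1_diffP/differentiable_continuous] := dM 0 (Ngt 0 (lexx 0)).
  have /cvgrPdist_lt/(_ (c / 2)) := cM; rewrite divr_gt0 // => /(_ isT).
  move=> /nbhs_ballP[r /= r0 Mr]; exists r => // s s0 sr.
  have /Mr : ball (0 : R) r s by rewrite /ball /= sub0r normrN ger0_norm.
  by rewrite distrC => /(le_lt_trans (ler_norm _)).
(* Below this threshold both energy terms are less than [c / 2]: the potential one by the choice of
   [r], the kinetic one by [c / (2 * eps)]. This contradicts [c <= E t]. *)
have d_gt0 : 0 < Num.min r (c / (2 * eps)).
  by rewrite lt_min r0 divr_gt0 // mulr_gt0.
apply: (limf_einf_gt0 d_gt0) => t t0; rewrite vE // sE // ip_norm leNgt; apply/negP.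
rewrite lt_min => /andP[sr vc].
have sr' : ip (u t) (A (u t)) < r by have := v_ge0 t; lra.
have := E_ge t t0; apply/negP; rewrite -ltNge /E.
have := Mr _ (s_ge0 t t0) sr'.
suff : eps * ip (v t) (v t) < c / 2 by lra.
have : ip (v t) (v t) < c / (2 * eps) by have := s_ge0 t t0; lra.
rewrite -(ltr_pM2l eps_gt0) => /lt_le_trans; apply.
by rewrite le_eqVlt; apply/orP; left; apply/eqP; field; rewrite gt_eqF.
Qed.
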